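(* In Morpion Solitaire 5D, starting from the standard initial configuration, the number of moves in any play cannot exceed $121$.
   Context: Morpion Solitaire 5D is a one-player game on the integer lattice $\mathbb{Z}^2$. Initially there are 36 crosses, placed on the lattice points lying on the boundary of the 12-sided polygon (a ''Greek cross'') with consecutive vertices $(3,0),(6,0),(6,3),(9,3),(9,6),(6,6),(6,9),(3,9),(3,6),(0,6),(0,3),(3,3)$; each of its 12 edges contains exactly 4 lattice points. A move consists of: (1) placing a new cross on a lattice point that currently has no cross; (2) drawing a line, i.e. a segment covering exactly 5 consecutive lattice points in one of the four directions (horizontal, vertical, or one of the two diagonals), such that all 5 covered points carry crosses and one of them is the cross placed in step (1). In the 5D variant, a newly drawn line may not share any lattice point with a previously drawn line of the same direction. The game is a sequence of legal moves; its score is the number of moves. *)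

(* Defs.v *)
From HB Require Import structures.
From mathcomp Require Import all_boot all_order all_algebra.

Set Implicit Arguments.
Unset Strict Implicit.
Unset Printing Implicit Defensive.

Import GRing.Theory.
Local Open Scope ring_scope.

Definition point : Type := (int * int)%type.

(* The points a, a + u, ..., a + (n - 1) u. *)
Definition progression (a u : point) (n : nat) : seq point :=
  [seq a + u *+ i | i <- iota 0 n].

Definition cross_vertices : seq point :=
  [:: (3, 0); (6, 0); (6, 3); (9, 3); (9, 6); (6, 6);
      (6, 9); (3, 9); (3, 6); (0, 6); (0, 3); (3, 3)].

(* The four lattice points of the edge from a to b. Every edge is parallel to
   an axis and has length 3, so the sign vector is the unit step along it; the
   lemma edge_points_last checks that the enumeration ends at b. *)
Definition edge_points (a b : point) : seq point :=
  progression a (sgz (b.1 - a.1), sgz (b.2 - a.2)) 4.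

Definition cross_edges : seq (point * point) :=
  zip cross_vertices (rot 1 cross_vertices).

Definition initial_crosses : seq point :=
  undup (flatten [seq edge_points e.1 e.2 | e <- cross_edges]).

Lemma edge_points_last :
  all (fun e => last e.1 (edge_points e.1 e.2) == e.2) cross_edges.
Proof. by vm_compute. Qed.

Lemma size_initial_crosses : size initial_crosses = 36.
Proof. by vm_compute. Qed.

Inductive direction := Horizontal | Vertical | Diagonal | Antidiagonal.

Definition direction_eqb (d e : direction) : bool :=
  match d, e with
  | Horizontal, Horizontal | Vertical, Vertical
  | Diagonal, Diagonal | Antidiagonal, Antidiagonal => true
  | _, _ => false
  end.

Lemma direction_eqP : Equality.axiom direction_eqb.
Proof. by case; case; constructor. Qed.

HB.instance Definition _ := hasDecEq.Build direction direction_eqP.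

Definition step (d : direction) : point :=
  match d with
  | Horizontal => (1, 0)
  | Vertical => (0, 1)
  | Diagonal => (1, 1)
  | Antidiagonal => (1, -1)
  end.

(* A segment of five consecutive lattice points, given by its direction and
   its first point along [step]; each segment has exactly one such encoding. *)
Record line := Line { line_dir : direction; line_start : point }.

Definition covered (l : line) : seq point :=
  progression (line_start l) (step (line_dir l)) 5.

Record move := Move { new_cross : point; new_line : line }.

Record position := Position { crosses : seq point; lines : seq line }.

Definition initial_position : position := Position initial_crosses [::].

Definition after (P : position) (m : move) : position :=
  Position (new_cross m :: crosses P) (new_line m :: lines P).

(* Lines of the same direction are compatible when they have no common
   lattice point; lines of different directions always are. *)
Definition compatible (l l' : line) : bool :=
  (line_dir l == line_dir l') ==> ~~ has (mem (covered l')) (covered l).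

Definition legal_move (P : position) (m : move) : bool :=
  [&& new_cross m \notin crosses P,
      all (mem (crosses (after P m))) (covered (new_line m)),
      new_cross m \in covered (new_line m)
    & all (compatible (new_line m)) (lines P)].

(* The moves are listed in the order in which they are played. *)
Fixpoint legal_play (P : position) (s : seq move) : bool :=
  if s is m :: s' then legal_move P m && legal_play (after P m) s' else true.

(* Main.v *)
Require Import Defs.
From mathcomp Require Import all_boot.
From mathcomp Require Import all_order all_algebra zify.

(** After 122 moves there would be 158 crosses and 122 lines. At most 31
    disjoint 5-point lines fit in each direction, so two directions [d <> e]
    have exactly 31 lines, each missing exactly 3 crosses. Split the crosses
    into 5 classes according to the residue mod 5 of a linear form constant
    along [d]: a line along [d] lies in a single class, whereas a line along
    [e] meets each class exactly once. Hence the class [c] has [31 + U_e c]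
    crosses, a number congruent to [U_d c] mod 5, where [U] counts the missed
    crosses. As [U <= 3], this forces [U_d c = U_e c + 1] for all five classes,
    which is incompatible with both totals being 3. *)

Set Implicit Arguments.
Unset Strict Implicit.
Unset Printing Implicit Defensive.

Import GRing.Theory.

(** Chosen to vanish on [step d] and to take a value among 1, -1, 2 on the other three steps; these
    values are all invertible mod 5. *)
Definition normal (d : direction) (p : point) : int :=
  match d with
  | Horizontal => p.2
  | Vertical => p.1
  | Diagonal => (p.1 - p.2)%R
  | Antidiagonal => (p.1 + p.2)%R
  end.

Definition in_class (d : direction) (c : nat) : pred point :=
  fun p => (normal d p %% 5)%Z == c.

Definition lines_along (d : direction) (L : seq line) : seq line :=
  [seq l <- L | line_dir l == d].

Definition points_along (d : direction) (L : seq line) : seq point :=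
  flatten [seq covered l | l <- lines_along d L].

Definition unused (d : direction) (P : position) : seq point :=
  [seq p <- crosses P | p \notin points_along d (lines P)].

(** The invariant of legal play on which the counting rests; the order of the moves no longer
    matters after it. *)
Definition sound (P : position) : Prop :=
  uniq (crosses P) /\
  forall d, uniq (points_along d (lines P)) /\
            {subset points_along d (lines P) <= crosses P}.

Lemma normal_shift (d : direction) (a u : point) (i : nat) :
  normal d (a + u *+ i)%R = (normal d a + normal d u *+ i)%R.
Proof.
case: a u => x y [v w].
have -> : ((v, w) *+ i = (v *+ i, w *+ i) :> point)%R.
  by elim: i => // i IH; rewrite !mulrSr IH.
by case: d => //=; lia.
Qed.

Lemma in_class_shift (d : direction) (c : nat) (a u : point) (i : nat) :
  in_class d c (a + u *+ i)%R = ((normal d a + normal d u *+ i) %% 5 == c)%Z.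
Proof. by rewrite /in_class normal_shift. Qed.

(** The form is constant along the line, so either all five points have residue [c] or none has. *)
Lemma count_class_parallel (l : line) (c : nat) :
  5 %| count (in_class (line_dir l) c) (covered l).
Proof.
rewrite count_map.
rewrite (eq_count (a2 := fun=> in_class (line_dir l) c (line_start l))).
  by case: in_class.
move=> i; rewrite [LHS]in_class_shift /in_class.
by case: line_dir; rewrite mul0rn addr0.
Qed.

(** The form advances by a unit mod 5 at each step, so five consecutive points run through every
    residue once. *)
Lemma count_class_transverse (d : direction) (l : line) (c : nat) :
  c < 5 -> line_dir l != d -> count (in_class d c) (covered l) = 1.
Proof.
move=> c5 neq; rewrite count_map (eq_count (in_class_shift d c _ _)) /=.
by move: neq (normal d _) => + b; case: d (line_dir l) => [] [] //= _; lia.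
Qed.

Lemma covered_uniq (l : line) : uniq (covered l).
Proof.
(* A form that is not constant along the line separates its points. *)
have [d neq] : exists d, line_dir l != d.
  by case: (line_dir l); [exists Vertical | exists Horizontal..].
rewrite map_inj_in_uniq ?iota_uniq // => i j; rewrite !mem_iota /= => i5 j5.
move/(congr1 (normal d)); rewrite !normal_shift => /addrI.
by case: d (line_dir l) neq => [] [] //= _; lia.
Qed.

Lemma points_along_cons (d : direction) (l : line) (L : seq line) :
  points_along d (l :: L) =
  (if line_dir l == d then covered l else [::]) ++ points_along d L.
Proof. by rewrite /points_along /lines_along /=; case: ifP. Qed.

Lemma size_points_along (d : direction) (L : seq line) :
  size (points_along d L) = 5 * size (lines_along d L).
Proof.
elim: L => // l L IH; rewrite points_along_cons size_cat IH /lines_along /=.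
by case: ifP => _ //=; rewrite mulnS.
Qed.

Lemma points_along_class (d : direction) (c : nat) (L : seq line) :
  5 %| count (in_class d c) (points_along d L).
Proof.
elim: L => // l L IH; rewrite points_along_cons count_cat dvdn_add //.
by case: eqP => // <-; exact: count_class_parallel.
Qed.

Lemma points_across_class (d e : direction) (c : nat) (L : seq line) :
  c < 5 -> e != d ->
  count (in_class d c) (points_along e L) = size (lines_along e L).
Proof.
move=> c5 ned; elim: L => // l L IH.
rewrite points_along_cons count_cat IH /lines_along /=.
by case: eqP => // eq_e; rewrite count_class_transverse ?eq_e.
Qed.

Lemma sum_lines_along (L : seq line) :
  size (lines_along Horizontal L) + size (lines_along Vertical L) +
  size (lines_along Diagonal L) + size (lines_along Antidiagonal L) = size L.
Proof.
rewrite /lines_along !size_filter; elim: L => //= l L.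
by case: (line_dir l) => /=; lia.
Qed.

Lemma sum_classes (d : direction) (s : seq point) :
  count (in_class d 0) s + count (in_class d 1) s + count (in_class d 2) s +
  count (in_class d 3) s + count (in_class d 4) s = size s.
Proof.
elim: s => //= p s; rewrite /in_class; move: (normal d p) => b; lia.
Qed.

Lemma compatible_disjoint (l : line) (L : seq line) :
  all (compatible l) L ->
  ~~ has (mem (covered l)) (points_along (line_dir l) L).
Proof.
elim: L => // l' L IH /= /andP[comp /IH{}IH].
rewrite points_along_cons has_cat negb_or IH andbT.
case: eqP => // dir_l; move: comp; rewrite /compatible dir_l eqxx implyTb.
by apply: contra => /hasP[p pl' pl]; apply/hasP; exists p.
Qed.

Lemma sound_initial : sound initial_position.
Proof. by split; [exact: undup_uniq | move=> d; split]. Qed.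

(** Freshness of the new cross keeps the crosses distinct; compatibility keeps lines of one
    direction disjoint. *)
Lemma sound_after (P : position) (m : move) :
  legal_move P m -> sound P -> sound (after P m).
Proof.
case/and4P => new_m /allP cov_m _ comp_m [uniqP alongP].
split; first by rewrite /= new_m.
move=> d; have [uniq_d sub_d] := alongP d; rewrite points_along_cons; split.
  case: eqP uniq_d => // <- uniq_m.
  by rewrite cat_uniq covered_uniq compatible_disjoint.
move=> p; rewrite mem_cat => /orP[|/sub_d p_in]; last by rewrite inE p_in orbT.
by case: eqP => // _ /cov_m.
Qed.

Lemma legal_play_sound (P : position) (s : seq move) :
  legal_play P s -> sound P ->
  exists Q, [/\ sound Q, size (crosses Q) = size (crosses P) + size s
              & size (lines Q) = size (lines P) + size s].
Proof.
elim: s P => [|m s IH] P /=; first by exists P; rewrite !addn0.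
case/andP => legal_m /IH{}IH /(sound_after legal_m)/IH[Q [sQ crQ liQ]].
by exists Q; rewrite crQ liQ /= !addSnnS.
Qed.

Lemma legal_play_take (P : position) (s : seq move) (n : nat) :
  legal_play P s -> legal_play P (take n s).
Proof.
by elim: s P n => [|m s IH] P [|n] //= /andP[-> /IH]; apply.
Qed.

Lemma count_unused (d : direction) (P : position) (a : pred point) :
  sound P ->
  count a (crosses P) =
  count a (points_along d (lines P)) + count a (unused d P).
Proof.
case=> uniqP /(_ d)[uniq_d sub_d]; rewrite -count_cat; move: a; apply/permP.
rewrite -(perm_filterC (mem (points_along d (lines P))) (crosses P)).
rewrite perm_cat2r; apply: uniq_perm; rewrite ?filter_uniq // => p.
by rewrite mem_filter andb_idr // => /sub_d.
Qed.

Lemma size_unused (d : direction) (P : position) :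
  sound P ->
  size (crosses P) = 5 * size (lines_along d (lines P)) + size (unused d P).
Proof.
by move=> sP; rewrite -size_points_along -!count_predT (count_unused d).
Qed.

(** Count the crosses of class [c] twice: lines along [d] contribute a multiple of 5, lines along
    [e] one cross each. *)
Lemma unused_class_mod (d e : direction) (P : position) (c : nat) :
  sound P -> c < 5 -> e != d ->
  count (in_class d c) (unused d P) =
  count (in_class d c) (unused e P) + size (lines_along e (lines P)) %[mod 5].
Proof.
move=> sP c5 ned; have := count_unused e (in_class d c) sP.
rewrite (count_unused d) // (points_across_class _ c5 ned) => eq_d.
have /dvdnP[k Dk] := points_along_class d c (lines P).
by rewrite [in RHS]addnC -eq_d Dk modnMDl.
Qed.

Lemma no_two_directions_of_31 (d e : direction) (P : position) :
  sound P -> e != d -> size (crosses P) = 158 ->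
  size (lines_along d (lines P)) = 31 -> size (lines_along e (lines P)) != 31.
Proof.
move=> sP ned sz ld; apply/eqP => le.
have := size_unused d sP; have := size_unused e sP; rewrite sz ld le.
have := sum_classes d (unused d P); have := sum_classes d (unused e P).
have class_mod c := @unused_class_mod d e P c sP.
have := class_mod 0 isT ned; have := class_mod 1 isT ned.
have := class_mod 2 isT ned; have := class_mod 3 isT ned.
(* Since 31 is 1 mod 5 and the counts are at most 3, the congruences become equalities; their sum
   over the classes reads 3 = 3 + 5. *)
have := class_mod 4 isT ned; rewrite le; lia.
Qed.

Theorem theorem5 (s : seq move) (hs : legal_play initial_position s) :
  size s <= 121.
Proof.
(* A longer play is cut to its first 122 moves, which fixes the number of crosses at 36 + 122 =
   158. *)
rewrite leqNgt; apply/negP => /size_takel size_s.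
have [P [sP]] := legal_play_sound (legal_play_take 122 hs) sound_initial.
rewrite size_s [crosses _]/= size_initial_crosses add0n => crP liP.
(* 32 disjoint lines would need 160 crosses. *)
have le31 d : size (lines_along d (lines P)) <= 31.
  by have := size_unused d sP; rewrite crP; lia.
have pair d e := @no_two_directions_of_31 d e P sP.
have := sum_lines_along (lines P); rewrite liP.
have := le31 Horizontal; have := le31 Vertical.
have := le31 Diagonal; have := le31 Antidiagonal.
have := pair Horizontal Vertical isT crP.
have := pair Horizontal Diagonal isT crP.
have := pair Horizontal Antidiagonal isT crP.
have := pair Vertical Diagonal isT crP.
have := pair Vertical Antidiagonal isT crP.
have := pair Diagonal Antidiagonal isT crP.
(* With at most one direction reaching 31, the total is at most 31 + 3 * 30 = 121. *)
lia.
Qed.
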